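(* Let $X$ be a real reflexive Banach space, $K\subset X$ a nonempty closed convex set, and $f:K\times K\to\mathbb{R}$ a bifunction with $f\in\overline{\mathcal{SQ}}(K)$. Suppose that $f_{\overline{q}}$ is quasimonotone, has the upper sign property on $K$, and satisfies the coercivity condition (C3). Then $\operatorname{EP}(f,K)$ is nonempty.
   Context: For $h:X\to[-\infty,+\infty]$ and $\lambda\in\mathbb{R}$ let $S_\lambda(h)=\{x\in X:h(x)\le\lambda\}$. The lower semicontinuous quasiconvex regularization of $h$ is $h_{\overline{q}}(x)=\inf\{\lambda\in\mathbb{R}:x\in\overline{\mathrm{co}}(S_\lambda(h))\}$ (with $\inf\emptyset=+\infty$), where $\overline{\mathrm{co}}$ is the norm-closed convex hull. For $f:K\times K\to\mathbb{R}$ and $x\in K$, extend $f(x,\cdot)$ to $X$ by $+\infty$ outside $K$ and put $f_{\overline{q}}(x,\cdot)=(f(x,\cdot))_{\overline{q}}$, regarded as a function on $K$. $\overline{\mathcal{Q}}(K)$ is the family of bifunctions $f:K\times K\to\mathbb{R}$ such that $f_{\overline{q}}(x,y)\in\mathbb{R}$ for all $x,y\in K$. A function $h:K\to\mathbb{R}$ is quasiconvex if $h(tx+(1-t)y)\le\max\{h(x),h(y)\}$ for all $x,y\in K$, $t\in[0,1]$; it is semistrictly quasiconvex if it is quasiconvex and, for all $x,y\in K$, $h(x)<h(y)$ implies $h(tx+(1-t)y)<h(y)$ for all $t\in\,]0,1[$. $\overline{\mathcal{SQ}}(K)$ is the family of $f\in\overline{\mathcal{Q}}(K)$ such that $f_{\overline{q}}(x,\cdot)$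 is semistrictly quasiconvex on $K$ for all $x\in K$. A bifunction $g:K\times K\to\mathbb{R}$ is quasimonotone if for all $x,y\in K$, $g(x,y)>0$ implies $g(y,x)\le0$. $g$ has the upper sign property on $K$ if for every $x\in K$ and every $y\in K$: if $g(x_t,x)\le0$ for all $t\in\,]0,1[$, where $x_t=(1-t)x+ty$, then $g(x,y)\ge0$. $g$ satisfies the coercivity condition (C3) if: for every sequence $\{x_n\}\subset K\setminus\{0\}$ such that $\lim_{n\to\infty}\|x_n\|=\infty$ and such that $\{\|x_n\|^{-1}x_n\}$ converges weakly to a point $x\in X$ with $y+x\in K$ and $g(y,x+y)\le0$ for all $y\in K$, there exists another sequence $\{u_n\}\subset K$ such that, for $n$ large enough, $\|u_n\|<\|x_n\|$ and $g(x_n,u_n)\le0$. $\operatorname{EP}(f,K)=\{x\in K:f(x,y)\ge0\text{ for all }y\in K\}$. *)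

(* Defs.v *)
From HB Require Import structures.
From mathcomp Require Import all_boot all_order all_algebra.
From mathcomp Require Import all_classical all_reals all_analysis.

Set Implicit Arguments.
Unset Strict Implicit.
Unset Printing Implicit Defensive.

Import Order.TTheory GRing.Theory Num.Theory.
Import numFieldNormedType.Exports.

Local Open Scope classical_set_scope.
Local Open Scope ring_scope.

Section duality.
Context {R : realType} (X : normedModType R).

Definition dual_space : set (X -> R^o) :=
  [set phi | linear phi /\ continuous phi].

Definition dual_norm (phi : X -> R^o) : R :=
  sup [set `|phi x| | x in [set x | `|x| <= 1]].

(* A functional on the dual is encoded by a total function on X -> R^o, whose
   values outside dual_space are never used. *)
Definition bidual_space : set ((X -> R^o) -> R) :=
  [set Phi |
    (forall (a : R) (phi psi : X -> R^o), dual_space phi -> dual_space psi ->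
       Phi (a *: phi + psi) = a * Phi phi + Phi psi) /\
    (exists M : R, forall phi : X -> R^o, dual_space phi ->
       `|Phi phi| <= M * dual_norm phi)].

Definition reflexive_space : Prop :=
  forall Phi, bidual_space Phi ->
    exists x : X, forall phi, dual_space phi -> Phi phi = phi x.

Definition weakly_cvg (u : nat -> X) (x : X) : Prop :=
  forall phi, dual_space phi -> phi (u n) @[n --> \oo] --> phi x.

End duality.

Section regularization.
Context {R : realType} {X : normedModType R}.

Definition convex_hull (A : set X) : set X := smallest (@convex_set R X) A.

Definition closed_convex_hull (A : set X) : set X := closure (convex_hull A).

Definition sublevel (h : X -> \bar R) (l : R) : set X :=
  [set x | (h x <= l%:E)%E].

Definition lsc_qcvx_reg (h : X -> \bar R) (x : X) : \bar R :=
  ereal_inf [set l%:E | l in [set l : R | closed_convex_hull (sublevel h l) x]].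

Definition extend_pinfty (K : set X) (h : X -> R) : X -> \bar R :=
  patch (fun=> +oo%E) K (EFin \o h).

End regularization.

(* A bifunction K * K -> R is encoded by a total function X -> X -> R; every
   notion below only depends on its values on K * K. *)
Section bifunctions.
Context {R : realType} {X : normedModType R}.
Implicit Types (K : set X) (h : X -> R) (f g : X -> X -> R).

Definition bifun_reg_ereal K f (x : X) : X -> \bar R :=
  lsc_qcvx_reg (extend_pinfty K (f x)).

Definition in_Qbar K f : Prop :=
  forall x y, K x -> K y -> bifun_reg_ereal K f x y \is a fin_num.

(* Meaningful on K * K when in_Qbar K f, since fine sends infinities to 0. *)
Definition bifun_reg K f : X -> X -> R :=
  fun x y => fine (bifun_reg_ereal K f x y).

Definition quasiconvex_on K h : Prop :=
  forall x y, K x -> K y -> forall t : R, 0 <= t <= 1 ->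
    h (t *: x + (1 - t) *: y) <= Num.max (h x) (h y).

Definition semistrictly_quasiconvex_on K h : Prop :=
  quasiconvex_on K h /\
  forall x y, K x -> K y -> h x < h y -> forall t : R, 0 < t < 1 ->
    h (t *: x + (1 - t) *: y) < h y.

Definition in_SQbar K f : Prop :=
  in_Qbar K f /\
  forall x, K x -> semistrictly_quasiconvex_on K (bifun_reg K f x).

Definition quasimonotone K g : Prop :=
  forall x y, K x -> K y -> 0 < g x y -> g y x <= 0.

Definition upper_sign_property K g : Prop :=
  forall x y, K x -> K y ->
    (forall t : R, 0 < t < 1 -> g ((1 - t) *: x + t *: y) x <= 0) ->
    0 <= g x y.

Definition coercivity_C3 K g : Prop :=
  forall (u : nat -> X) (x : X),
    (forall n, K (u n) /\ u n != 0) ->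
    `|u n| @[n --> \oo] --> +oo ->
    weakly_cvg (fun n => `|u n|^-1 *: u n) x ->
    (forall y, K y -> K (y + x) /\ g y (x + y) <= 0) ->
    exists v : nat -> X, (forall n, K (v n)) /\
      \forall n \near \oo, `|v n| < `|u n| /\ g (u n) (v n) <= 0.

Definition EP f K : set X :=
  [set x | K x /\ forall y, K y -> 0 <= f x y].

End bifunctions.

(* Main.v *)
Require Import Defs.
From HB Require Import structures.
From mathcomp Require Import all_boot all_order all_algebra.
From mathcomp Require Import all_classical all_reals all_analysis.
From mathcomp Require Import ring lra.

(** Write [g] for the regularized bifunction.  Since [g <= f] on [K * K], an
    equilibrium of [g] is one of [f].  Three features of [g] matter: its
    sublevel sets in the second variable are closed and convex, hence weakly
    closed; the upper sign property and quasimonotonicity force [g x x = 0];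
    and semistrict quasiconvexity makes a local solution global: if [g x v <= 0]
    and [g x] is nonnegative near [v], a point [y] with [g x y < 0] would make
    [g x] negative on the whole open segment from [y] to [v]
    ([local_to_global]).  The upper sign property turns a solution of the Minty
    problem ([g y x <= 0] for all [y]) into an equilibrium, on any convex
    subset ([minty_stampacchia]), so even a local Minty solution suffices
    ([local_minty]).

    Call [g] properly quasimonotone when each point [x] of the closed convex
    hull of a finite set of points of [K] has [g y x <= 0] for some [y] in that
    finite set.

    If [g] is not properly quasimonotone, some [x] in the hull of a finite [s]
    has [g y x > 0] for all [y] in [s].  This persists near [x]; there
    quasimonotonicity gives [g z y <= 0] for all [y] in [s], and convexity of
    the sublevel sets gives [g z x <= 0]: [x] is a local Minty solution.

    If [g] is properly quasimonotone, the sets [{x | g y x <= 0}] satisfy the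
    hypothesis of the Knaster-Kuratowski-Mazurkiewicz theorem.  As they are
    convex, an elementary argument gives its conclusion: [convex_kkm] follows by
    induction from Klee's intersection theorem [klee], itself an induction that
    cuts by separating hyperplanes.  Weak compactness then yields a Minty
    solution on each truncation of [K] to a ball.  If one of them lies in the
    interior of its ball, it is a local Minty solution on [K].  Otherwise there
    are solutions [u n] on spheres with radii going to infinity; after passing
    to a subsequence the normalized [u n] converge weakly to some [x], and
    [(1 - 1 / |u n|) y + u n / |u n|] shows that [y + x] lies in the sublevel
    set of every [y] in [K], so that the coercivity condition applies.  It
    provides [v] in the interior of the ball with [g (u n) v <= 0], and
    [local_to_global] at [v] shows that [u n] is an equilibrium on all of [K].

    The functional analysis behind this: the Hahn-Banach theorem, obtained from
    minimal sublinear functionals; separation from a convex set, with Mazur's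
    theorem as a consequence; and, in a reflexive space, the weak convergence
    of bounded ultrafilters, from which come weak compactness and (following
    Whitley) weak sequential compactness of bounded sequences. *)

Set Implicit Arguments.
Unset Strict Implicit.
Unset Printing Implicit Defensive.

Import Order.TTheory GRing.Theory Num.Theory.
Import numFieldNormedType.Exports.

Local Open Scope classical_set_scope.
Local Open Scope ring_scope.

(** * The Hahn-Banach theorem and separation *)
Section hahn_banach.
Context {R : realType} {V : lmodType R}.
Implicit Types (p q r : V -> R).

(** The inequality in the second clause, for all positive [t], already gives
    equality; as an inequality it passes directly to infima. *)
Definition sublinear q : Prop :=
  (forall x y, q (x + y) <= q x + q y) /\
  (forall (t : R) x, 0 < t -> q (t *: x) <= t * q x).

Lemma sublinearZ q (t : R) x : sublinear q -> 0 < t -> q (t *: x) = t * q x.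
Proof.
move=> [_ qZ] t0; apply/eqP; rewrite eq_le qZ//= -ler_pdivlMl//.
by rewrite -{1}[x]scale1r -(mulVf (lt0r_neq0 t0)) -scalerA qZ ?invr_gt0.
Qed.

Lemma sublinear0 q : sublinear q -> q 0 = 0.
Proof.
move=> sq; have := sublinearZ 0 sq (ltr0n _ 2); rewrite scaler0 => ?; lra.
Qed.

Lemma sublinear_ge q x : sublinear q -> - q (- x) <= q x.
Proof.
by move=> sq; rewrite -subr_ge0 opprK -(sublinear0 sq) -(subrr x); case: sq.
Qed.

(** One construction serves for lower bounds of chains, for the competitor that
    shows additivity of minimal functionals, and for the gauge of a convex set:
    a pointwise infimum is sublinear as soon as the family absorbs sums and
    positive multiples. *)
Lemma sublinear_inf (I : Type) (D : set I) (F : I -> V -> R) (b : V -> R) :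
  D !=set0 ->
  (forall i x, D i -> b x <= F i x) ->
  (forall i j x y, D i -> D j ->
     exists2 k, D k & F k (x + y) <= F i x + F j y) ->
  (forall i x (t : R), D i -> 0 < t ->
     exists2 k, D k & F k (t *: x) <= t * F i x) ->
  exists q, [/\ sublinear q, (forall i x, D i -> q x <= F i x) &
    (forall x m, (forall i, D i -> m <= F i x) -> m <= q x)].
Proof.
move=> [i0 Di0] bF FD FZ; pose q x := inf [set F i x | i in D].
have qle i x : D i -> q x <= F i x.
  move=> Di; apply: ge_inf; last by exists i.
  by exists (b x) => _ [j Dj <-]; exact: bF.
have q_ge x m : (forall i, D i -> m <= F i x) -> m <= q x.
  move=> mF; apply: lb_le_inf; first by exists (F i0 x), i0.
  by move=> _ [j Dj <-]; exact: mF.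
exists q; split=> //; split=> [x y|t x t0].
  rewrite -lerBlDr; apply: (q_ge x) => i Di; rewrite lerBlDr -lerBlDl.
  apply: (q_ge y) => j Dj; rewrite lerBlDl.
  have [k Dk Fk] := FD i j x y Di Dj.
  exact: le_trans (qle _ _ Dk) Fk.
rewrite -ler_pdivrMl//; apply: (q_ge x) => i Di; rewrite ler_pdivrMl//.
by have [k Dk Fk] := FZ i x t Di t0; exact: le_trans (qle _ _ Dk) Fk.
Qed.

(** Zorn's lemma applies because the infimum of a chain of sublinear functionals
    below [p] stays above [x |-> - p (- x)]. *)
Lemma minimal_sublinear p : sublinear p -> exists q,
  [/\ sublinear q, (forall x, q x <= p x) &
    forall r, sublinear r -> (forall x, r x <= q x) -> r = q].
Proof.
move=> sp; pose T := {q | sublinear q /\ forall x, q x <= p x}.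
pose le (a b : T) := `[< forall x, sval b x <= sval a x >].
have [||||[q [sq qp]] qmin] := @Zorn T le.
- by move=> a; apply/asboolP.
- move=> a b c /asboolP ab /asboolP bc; apply/asboolP => x.
  exact: le_trans (bc x) (ab x).
- move=> [a Ha] [b Hb] /asboolP/= ab /asboolP/= ba.
  apply: eq_exist; apply/funext => x; apply/eqP.
  by rewrite eq_le ab ba.
- move=> A Atot; have [[a0 Aa0]|A0] := pselect (A !=set0); last first.
    exists (exist _ p (conj sp (fun x => lexx _))) => a Aa.
    by exfalso; apply: A0; exists a.
  have [q [sq qA _]] : exists q, [/\ sublinear q,
      (forall a x, A a -> q x <= sval a x) &
      (forall x m, (forall a, A a -> m <= sval a x) -> m <= q x)].
    apply: (@sublinear_inf _ A (fun a => sval a) (fun x => - p (- x))).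
    + by exists a0.
    + move=> [a [sa ap]] x _ /=; apply: le_trans (sublinear_ge x sa).
      by rewrite lerN2 ap.
    + move=> a b x y Aa Ab; have [/asboolP|/asboolP] := Atot _ _ Aa Ab.
      * move=> ab; exists b => //.
        apply: le_trans (_ : sval b x + sval b y <= _).
          by case: (b) => b' [[+ _] _] /=; exact.
        by rewrite lerD2r.
      * move=> ba; exists a => //.
        apply: le_trans (_ : sval a x + sval a y <= _).
          by case: (a) => a' [[+ _] _] /=; exact.
        by rewrite lerD2l.
    + move=> a x t Aa t0; exists a => //.
      by rewrite sublinearZ//; case: (a) => ? [].
  have qp x : q x <= p x.
    by apply: le_trans (qA _ _ Aa0) _; case: (a0) => a [? /=]; exact.
  exists (exist _ q (conj sq qp)) => a Aa; apply/asboolP => x /=; exact: qA.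
exists q; split=> // r sr rq.
have rp x : r x <= p x by exact: le_trans (rq x) (qp x).
have := qmin (exist _ r (conj sr rp)) => /(_ _)/(congr1 sval)/= -> //.
by apply/asboolP.
Qed.

(** A minimal sublinear functional is linear: for every [y] the functional
    [z |-> inf_(t >= 0) (q (z + t y) - t q y)] is sublinear and below [q], hence
    equal to [q], and [t = 1] gives [q z + q y <= q (z + y)]. *)
Theorem hahn_banach p : sublinear p ->
  exists phi : V -> R^o, linear phi /\ forall x, phi x <= p x.
Proof.
move=> /minimal_sublinear[q [sq qp qmin]].
have qD x y : q (x + y) = q x + q y.
  apply/eqP; rewrite eq_le (sq.1 x y)/=.
  have [r [sr rF Fr]] : exists r, [/\ sublinear r,
      (forall (t : R) z, 0 <= t -> r z <= q (z + t *: y) - t * q y) &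
      (forall z m, (forall t : R, 0 <= t -> m <= q (z + t *: y) - t * q y) ->
         m <= r z)].
    apply: (@sublinear_inf _ [set t : R | 0 <= t]
      (fun t z => q (z + t *: y) - t * q y) (fun z => - q (- z))).
    - by exists 0 => /=.
    - move=> t z /= t0; rewrite lerBrDr addrC lerBlDr.
      have -> : t * q y = q (t *: y).
        move: t0; rewrite le_eqVlt => /predU1P[<-|t0]; last first.
          by rewrite sublinearZ.
        by rewrite mul0r scale0r sublinear0.
      by apply: le_trans (sq.1 _ _); rewrite addrAC subrr add0r.
    - move=> t s z w /= t0 s0; exists (t + s); first exact: addr_ge0.
      rewrite scalerDl addrACA mulrDl; have := sq.1 (z + t *: y) (w + s *: y).
      by move=> ?; lra.
    - move=> t z a /= t0 a0; exists (a * t); first by rewrite mulr_ge0// ltW.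
      by rewrite -scalerA -scalerDr sublinearZ// mulrBr mulrA.
  have rq : r = q.
    apply: qmin => // z; apply: le_trans (rF 0 z (lexx _)) _.
    by rewrite scale0r addr0 mul0r subr0.
  by have := rF 1 x ler01; rewrite rq scale1r mul1r lerBrDr.
have qN x : q (- x) = - q x.
  by apply/eqP; rewrite -addr_eq0 -qD addNr sublinear0.
have qZ (t : R) x : q (t *: x) = t * q x.
  have [t0|t0|->] := ltgtP t 0.
  - rewrite -[in LHS](opprK t) scaleNr qN sublinearZ ?oppr_gt0//; ring.
  - exact: sublinearZ.
  - by rewrite scale0r mul0r sublinear0.
by exists q; split=> // t x y; rewrite qD qZ.
Qed.

End hahn_banach.

Section separation.
Context {R : realType} {X : normedModType R}.
Implicit Types (C : set X) (phi : X -> R^o).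

Lemma convex_setP C : @convex_set R X C <->
  forall x y (t : R), C x -> C y -> 0 <= t <= 1 -> C (t *: x + (1 - t) *: y).
Proof.
split=> [cC x y t Cx Cy t01|cC x y t /set_mem Cx /set_mem Cy]; last first.
  apply/mem_set; apply: cC => //; by rewrite ge0 le1.
by have := cC x y (Itv01 (proj1 (andP t01)) (proj2 (andP t01)))
  (mem_set Cx) (mem_set Cy) => /set_mem.
Qed.

(** For bundled linear maps, continuity is equivalent to boundedness. *)
Lemma linear_bundle phi : linear phi ->
  exists f : {linear X -> R^o}, phi = f :> (X -> R^o).
Proof.
move=> hphi.
pose fL := GRing.isLinear.Build R X R^o *:%R phi hphi.
pose f : {linear X -> R^o} := HB.pack phi fL.
by exists f.
Qed.

Lemma dual_linear phi : dual_space phi ->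
  [/\ (forall x y, phi (x + y) = phi x + phi y),
      (forall x y, phi (x - y) = phi x - phi y) &
      (forall (t : R) x, phi (t *: x) = t * phi x)].
Proof.
move=> [/linear_bundle[f ->] _]; split=> [x y|x y|t x].
- exact: linearD.
- exact: linearB.
- exact: linearZ.
Qed.

Lemma le_norm_dual phi : linear phi -> (forall z, phi z <= `|z|) ->
  dual_space phi.
Proof.
move=> lphi phi_le; split=> //; have [f fE] := linear_bundle lphi.
rewrite fE in phi_le *; apply: bounded_linear_continuous.
apply/linear_boundedP; near=> r => x.
have r1 : 1 <= r by near: r; exact: nbhs_pinfty_ge.
apply: le_trans (_ : `|x| <= _); last by rewrite ler_peMl.
rewrite ler_norml phi_le andbT lerNl -linearN.
by rewrite -(normrN x) phi_le.
Unshelve. all: by end_near. Qed.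

(** Hahn-Banach applied to the infimum of [|z + t (x0 - c)| - t delta] over
    [t >= 0] and [c] in [C]: it is at most [|z|], by [t = 0], and at most
    [- delta] at [z = c - x0], by [t = 1]; the distance hypothesis bounds it
    below by [- |z|]. *)
Lemma separation C (x0 : X) (delta : R) : @convex_set R X C -> C !=set0 ->
  (forall c, C c -> delta <= `|x0 - c|) ->
  exists phi, [/\ dual_space phi, (forall z, phi z <= `|z|) &
    forall c, C c -> phi c + delta <= phi x0].
Proof.
move=> /convex_setP cC [c0 Cc0] dC.
pose F (i : R * X) z := `|z + i.1 *: (x0 - i.2)| - i.1 * delta.
have [p [sp pF _]] : exists p, [/\ sublinear p,
    (forall i z, 0 <= i.1 /\ C i.2 -> p z <= F i z) &
    (forall z m, (forall i, 0 <= i.1 /\ C i.2 -> m <= F i z) -> m <= p z)].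
  apply: (@sublinear_inf _ _ _ [set i | 0 <= i.1 /\ C i.2] F (fun z => - `|z|)).
  - by exists (0, c0).
  - move=> [t c] z /= [t0 Cc]; rewrite /F/=.
    have : t * delta <= `|t *: (x0 - c)|.
      by rewrite normrZ ger0_norm// ler_wpM2l ?dC.
    have := lerB_normD (t *: (x0 - c)) z; rewrite [_ + z]addrC; lra.
  - move=> [t c] [s d] z w /= [t0 Cc] [s0 Cd].
    have [ts0|ts0] := eqVneq (t + s) 0.
      exists (0, c) => //; rewrite /F/=.
      have -> : t = 0 by lra.
      have -> : s = 0 by lra.
      by rewrite !scale0r !mul0r !addr0 !subr0 ler_normD.
    have tsp : 0 < t + s by rewrite lt_neqAle eq_sym ts0 addr_ge0.
    (* A convex combination [e] of [c] and [d] has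
       [t (x0 - c) + s (x0 - d) = (t + s) (x0 - e)]. *)
    pose e := t / (t + s) *: c + (1 - t / (t + s)) *: d.
    have Ce : C e.
      apply: cC => //; rewrite divr_ge0 ?addr_ge0//=.
      by rewrite ler_pdivrMr// mul1r lerDl.
    have eE : (t + s) *: (x0 - e) = t *: (x0 - c) + s *: (x0 - d).
      rewrite /e scalerBr scalerDr !scalerA mulrBr mulr1 mulrCA divff// mulr1.
      rewrite addrAC subrr add0r !scalerBr scalerDl opprD.
      by rewrite addrACA.
    exists (t + s, e); rewrite /F/=; first by split => //; exact: ltW.
    rewrite eE addrACA mulrDl.
    have := ler_normD (z + t *: (x0 - c)) (w + s *: (x0 - d)); lra.
  - move=> [t c] z a /= [t0 Cc] a0; exists (a * t, c) => /=.
      by rewrite mulr_ge0// ltW.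
    by rewrite /F/= -scalerA -scalerDr normrZ gtr0_norm// mulrBr mulrA.
have [phi [lphi phip]] := hahn_banach sp.
have phi_le z : phi z <= `|z|.
  apply: le_trans (phip z) _; apply: le_trans (pF (0, c0) z _) _ => //.
  by rewrite /F/= scale0r mul0r addr0 subr0.
exists phi; have dphi := le_norm_dual lphi phi_le; split=> // c Cc.
have [_ phiB _] := dual_linear dphi.
have := le_trans (phip (c - x0)) (pF (1, c) _ (conj ler01 Cc)).
rewrite /F/= scale1r mul1r addrA subrK subrr normr0 phiB; lra.
Qed.

End separation.

(** * Weak limits in reflexive spaces *)

(** If [f] did not converge along [F], the trace of [F] on the complement of the
    preimage of some neighbourhood would extend to an ultrafilter. *)
Lemma cvg_ultra (T : Type) (Y : topologicalType) (F : set_system T)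
    (FF : ProperFilter F) (f : T -> Y) (l : Y) :
  (forall W, UltraFilter W -> F `<=` W -> f t @[t --> W] --> l) ->
  f t @[t --> F] --> l.
Proof.
move=> fW N Nl; apply: contrapT => FN.
have PG : ProperFilter (within (~` (f @^-1` N)) F).
  apply: Build_ProperFilter_ex.
  move=> P FP; apply: contrapT => P0; apply: FN.
  change (F (f @^-1` N)).
  refine (filterS _ (FP : F [set t | (~` (f @^-1` N)) t -> P t])) => t Pt.
  apply: contrapT => fNt.
  by apply: P0; exists t; exact: Pt.
have [W [UW GW]] := ultraFilterLemma PG.
have FW : F `<=` W by move=> A FA; apply: GW; apply: filterS FA.
have WN : W (f @^-1` N) by exact: (fW W UW FW).
have WnN : W (~` (f @^-1` N)) by apply: GW; exact: withinT.
by have [t [? ?]] := filter_ex (filterI WN WnN).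
Qed.

Section weak_convergence.
Context {R : realType} {X : normedModType R}.
Implicit Types (A B C : set X) (phi : X -> R^o).

Lemma closure_normP A y :
  closure A y <-> forall e, 0 < e -> exists2 a, A a & `|y - a| < e.
Proof.
split=> [Ay e e0|Ay N /nbhs_ballP[e /= e0 eN]].
  have [|a [Aa]] := Ay (ball y e); first exact: nbhsx_ballx.
  by rewrite -ball_normE; exists a.
have [a Aa ya] := Ay e e0; exists a; split=> //.
by apply: eN; rewrite -ball_normE.
Qed.

Lemma dual_bounded phi : dual_space phi ->
  exists2 M : R, 0 < M & forall x, `|phi x| <= M * `|x|.
Proof.
move=> [/linear_bundle[f fE] cphi]; rewrite fE in cphi *.
have /(_ 0) cf := cphi.
have /linear_boundedP/pinfty_ex_gt0[M M0 fM] := continuous_linear_bounded 0 cf.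
by exists M.
Qed.

Lemma dual0 phi : dual_space phi -> phi 0 = 0.
Proof. by move=> /dual_linear[_ phiB _]; rewrite -(subrr 0) phiB subrr. Qed.

Lemma dual_norm_ge phi x : dual_space phi ->
  `|phi x| <= dual_norm phi * `|x|.
Proof.
move=> dphi; have [M M0 phiM] := dual_bounded dphi.
have [_ _ phiZ] := dual_linear dphi.
have [->|x0] := eqVneq x 0; first by rewrite dual0// !normr0 mulr0.
have nx : 0 < `|x| by rewrite normr_gt0.
rewrite -ler_pdivrMr//; apply: ub_le_sup.
  exists M => _ [y /= y1 <-]; apply: le_trans (phiM y) _.
  by rewrite ler_piMr// ltW.
exists (`|x|^-1 *: x) => /=.
  by rewrite normrZ normfV normr_id mulVf// lt0r_neq0.
by rewrite phiZ normrM normfV normr_id mulrC.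
Qed.

(** Along an ultrafilter each bounded scalar family converges, so that
    [phi |-> lim phi (u t)] is an element of the bidual; reflexivity represents
    it by a point. *)
Lemma ultra_weak_limit (hX : reflexive_space X) (T : Type) (U : set_system T)
    (UU : UltraFilter U) (u : T -> X) (M : R) :
  (\forall t \near U, `|u t| <= M) ->
  exists x, forall phi, dual_space phi -> phi (u t) @[t --> U] --> phi x.
Proof.
move=> uM.
have lphi phi : dual_space phi ->
    exists2 l : R^o, phi (u t) @[t --> U] --> l & `|l| <= M * dual_norm phi.
  move=> dphi; have bphi : \forall t \near U, `|phi (u t)| <= M * dual_norm phi.
    near=> t; apply: le_trans (dual_norm_ge (u t) dphi) _.
    rewrite mulrC ler_wpM2r//; last by near: t.
    apply: ub_le_sup; last first.
      by exists 0; [rewrite /= normr0|rewrite (dual0 dphi) normr0].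
    have [K K0 phiK] := dual_bounded dphi.
    exists K => _ [y /= y1 <-]; apply: le_trans (phiK y) _.
    by rewrite ler_piMr// ltW.
  have /(_ (phi (u t) @[t --> U])) := @segment_compact R
    (- (M * dual_norm phi)) (M * dual_norm phi).
  case.
    apply: filterS bphi => t; by rewrite /= in_itv/= ler_norml.
  move=> l [/=]; rewrite in_itv/= -ler_norml => lM cl; exists l => // N Nl.
  have [//|WN] := in_ultra_setVsetC ((phi \o u) @^-1` N) UU.
  have [r [? ?]] : (~` N) `&` N !=set0 by apply: cl.
  by [].
pose Phi phi : R := lim (phi (u t) @[t --> U]).
have PhiE phi : dual_space phi -> phi (u t) @[t --> U] --> (Phi phi : R^o).
  by move=> /lphi[l ul _]; apply/cvg_ex; exists l.
have [|x xPhi] := hX Phi.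
  split=> [a phi psi dphi dpsi|]; last first.
    exists M => phi dphi; have [l ul lM] := lphi _ dphi.
    by rewrite /Phi (cvg_lim _ ul)//.
  apply: cvg_lim => //=.
  have := cvgD (@cvgZl_tmp _ _ _ _ _ a _ _ (PhiE _ dphi)) (PhiE _ dpsi).
  exact.
by exists x => phi dphi; rewrite -xPhi//; exact: PhiE.
Unshelve. all: by end_near. Qed.

(** A closed convex set that misses [x] is separated from [x] by a continuous
    functional, whose values then cannot converge to its value at [x]. *)
Lemma mazur (T : Type) (F : set_system T) (FF : ProperFilter F) (u : T -> X)
    x C :
  closed C -> @convex_set R X C ->
  (forall phi, dual_space phi -> phi (u t) @[t --> F] --> phi x) ->
  (\forall t \near F, C (u t)) -> C x.
Proof.
move=> clC cC ux Cu; apply: contrapT => Cx.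
have [d d0 dC] : exists2 d, 0 < d & forall c, C c -> d <= `|x - c|.
  apply: contrapT => nd; apply: Cx; apply: clC; apply/closure_normP => e e0.
  apply: contrapT => ne; apply: nd; exists e => // c Cc; rewrite leNgt.
  by apply/negP => xc; apply: ne; exists c.
have C0 : C !=set0 by have [t Ct] := filter_ex Cu; exists (u t).
have [phi [dphi _ phiC]] := separation cC C0 dC.
have : phi x <= phi x - d.
  apply: (@closed_cvg T R^o F FF (phi \o u) (fun r => r <= phi x - d) _ _
    (phi x) (ux _ dphi)); first exact: closed_le.
  by apply: filterS Cu => t /phiC; rewrite lerBrDr.
lra.
Qed.

(** The sets are at positive distance: otherwise sequences in [A] and [B] with
    differences going to zero would share a weak limit along an ultrafilter.
    So [0] is at positive distance from the convex set [B - A]. *)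
Lemma strict_separation (hX : reflexive_space X) A B (M : R) :
  closed A -> closed B -> @convex_set R X A -> @convex_set R X B ->
  A !=set0 -> B !=set0 -> (forall a, A a -> `|a| <= M) -> A `&` B = set0 ->
  exists phi (r : R), [/\ dual_space phi, (forall a, A a -> r < phi a) &
    forall b, B b -> phi b < r].
Proof.
move=> clA clB cA cB [a0 Aa0] [b0 Bb0] AM AB0.
have [d d0 dAB] :
    exists2 d, 0 < d & forall a b, A a -> B b -> d <= `|b - a|.
  apply: contrapT => nd.
  have /choice[ab abP] (n : nat) : exists ab : X * X,
      [/\ A ab.1, B ab.2 & `|ab.2 - ab.1| < n.+1%:R^-1].
    apply: contrapT => nab; apply: nd; exists n.+1%:R^-1 => // a b Aa Bb.
    by rewrite leNgt; apply/negP => ba; apply: nab; exists (a, b).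
  have [W [UW FW]] := ultraFilterLemma eventually_filter.
  have [|x xl] := @ultra_weak_limit hX _ W UW (fun n => (ab n).1) M.
    by apply: FW; exists 0%N => // n _ /=; apply: AM; have [] := abP n.
  have Ax : A x.
    apply: (@mazur _ W _ (fun n => (ab n).1) _ _ clA cA xl).
    by apply: nearW => n; have [] := abP n.
  have xl2 phi : dual_space phi -> phi (ab t).2 @[t --> W] --> phi x.
    move=> dphi; have [phiD phiB _] := dual_linear dphi.
    have -> : (fun t => phi (ab t).2) =
        (fun t => phi (ab t).1 + phi ((ab t).2 - (ab t).1)).
      by apply/funext => t; rewrite phiB addrC subrK.
    rewrite -[phi x]addr0; apply: cvgD; first exact: xl.
    have ab0 : (ab n).2 - (ab n).1 @[n --> \oo] --> (0 : X).
      apply/norm_cvg0P.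
      apply: (@squeeze_cvgr _ _ _ _ (fun=> 0) (fun n => n.+1%:R^-1)).
      - by apply: nearW => n; rewrite normr_ge0/= ltW//; have [] := abP n.
      - exact: cvg_cst.
      - exact: cvg_harmonic.
    have phi0 : {for 0, continuous phi} by case: dphi => _; exact.
    rewrite -(dual0 dphi).
    apply: (cvg_trans (cvg_app _ FW)).
    exact: (@continuous_cvg nat X R^o \oo _
      (fun n => (ab n).2 - (ab n).1) phi 0 phi0 ab0).
  have Bx : B x.
    apply: (@mazur _ W _ (fun n => (ab n).2) _ _ clB cB xl2).
    by apply: nearW => n; have [] := abP n.
  suff : (set0 : set X) x by [].
  by rewrite -AB0; split.
pose C := [set b - a | b in B & a in A].
have cC : @convex_set R X C.
  apply/convex_setP => _ _ t [b Bb [a Aa <-]] [b' Bb' [a' Aa' <-]] t01.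
  exists (t *: b + (1 - t) *: b'); first by move/convex_setP : cB; exact.
  exists (t *: a + (1 - t) *: a'); first by move/convex_setP : cA; exact.
  by rewrite !scalerBr opprD addrACA.
have C0 : C !=set0 by exists (b0 - a0); exists b0 => //; exists a0.
have [|phi [dphi _ phiC]] := @separation _ _ C 0 d cC C0.
  by move=> _ [b Bb [a Aa <-]]; rewrite sub0r normrN; exact: dAB.
have [_ phiB _] := dual_linear dphi.
have phiAB a b : A a -> B b -> phi b + d <= phi a.
  move=> Aa Bb; have : phi (b - a) + d <= phi 0.
    by apply: phiC; exists b => //; exists a.
  by rewrite phiB dual0//; lra.
pose s := sup [set phi b | b in B].
have sB b : B b -> phi b <= s.
  move=> Bb; apply: ub_le_sup; last by exists b.
  by exists (phi a0) => _ [c Bc <-]; have := phiAB _ _ Aa0 Bc; lra.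
have sA a : A a -> s <= phi a - d.
  move=> Aa; apply: ge_sup; first by exists (phi b0); exists b0.
  by move=> _ [c Bc <-]; have := phiAB _ _ Aa Bc; lra.
exists phi, (s + d / 2); split=> // [a /sA|b /sB]; lra.
Qed.

End weak_convergence.

(** * Weak sequential compactness *)
Section sequential_compactness.
Context {R : realType} {X : normedModType R}.
Implicit Types (phi : X -> R^o) (u : nat -> X).

(** Finite rational combinations of the terms of [u], possibly with repeated
    indices: sums become concatenations, and the index type is countable. *)
Definition rat_comb u (s : seq (rat * nat)) : X :=
  \sum_(p <- s) ratr p.1 *: u p.2.

Lemma rat_combD u s t : rat_comb u s + rat_comb u t = rat_comb u (s ++ t).
Proof. by rewrite /rat_comb big_cat. Qed.

Lemma rat_combZ u (q : rat) s :
  ratr q *: rat_comb u s = rat_comb u [seq (q * p.1, p.2) | p <- s].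
Proof.
rewrite /rat_comb big_map scaler_sumr; apply: eq_bigr => p _ /=.
by rewrite scalerA rmorphM.
Qed.

Lemma closure_rat_combD u x y : closure (range (rat_comb u)) x ->
  closure (range (rat_comb u)) y -> closure (range (rat_comb u)) (x + y).
Proof.
move=> /closure_normP ux /closure_normP uy; apply/closure_normP => e e0.
have e20 : 0 < e / 2 by rewrite divr_gt0.
have [_ [s _ <-] xs] := ux _ e20; have [_ [t _ <-] yt] := uy _ e20.
exists (rat_comb u (s ++ t)); first by exists (s ++ t).
rewrite -rat_combD opprD addrACA (le_lt_trans (ler_normD _ _))//.
by rewrite [e]splitr ltrD.
Qed.

Lemma closure_rat_combZ u (a : R) x : closure (range (rat_comb u)) x ->
  closure (range (rat_comb u)) (a *: x).
Proof.
move=> /closure_normP ux; apply/closure_normP => e e0.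
have a0 : 0 < `|a| + 1 by rewrite ltr_wpDl.
have [|_ [s _ <-] xs] := ux (e / 2 / (`|a| + 1)); first by rewrite !divr_gt0.
set c := rat_comb u s in xs *.
have c0 : 0 < `|c| + 1 by rewrite ltr_wpDl.
have [|q] := @rat_in_itvoo R a (a + e / 2 / (`|c| + 1)).
  by rewrite ltrDl !divr_gt0.
rewrite in_itv/= => /andP[aq qa].
exists (ratr q *: c); first by rewrite rat_combZ; eexists.
have -> : a *: x - ratr q *: c = a *: (x - c) - (ratr q - a) *: c.
  by rewrite scalerBr scalerBl opprB addrA subrK.
have qa0 : 0 < ratr q - a by rewrite subr_gt0.
rewrite (le_lt_trans (ler_normB _ _))// !normrZ (gtr0_norm qa0).
have h1 : `|a| * `|x - c| <= e / 2.
  apply: le_trans (_ : (`|a| + 1) * `|x - c| <= _).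
    by rewrite ler_wpM2r// lerDl.
  by rewrite -ler_pdivlMl// mulrC ltW.
have h2 : (ratr q - a) * `|c| < e / 2.
  apply: le_lt_trans (_ : (ratr q - a) * (`|c| + 1) < _).
    by rewrite ler_wpM2l ?lerDl// subr_ge0 ltW.
  by rewrite -ltr_pdivlMr// ltrBlDl.
by rewrite [e]splitr ler_ltD.
Qed.

(** Take [phi k] norming [d k].  If all [phi k] vanish at [z] and [d k] is close
    to [z], then [|d k| <= phi k (d k - z)] is small, and so is [|z|]. *)
Lemma total_sequence (d : nat -> X) :
  exists phi : nat -> X -> R^o, (forall k, dual_space (phi k)) /\
    forall z, closure (range d) z -> (forall k, phi k z = 0) -> z = 0.
Proof.
have /choice[phi phiP] (k : nat) : exists phi : X -> R^o,
    [/\ dual_space phi, (forall z, phi z <= `|z|) & `|d k| <= phi (d k)].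
  have c0 : @convex_set R X [set 0].
    by apply/convex_setP => _ _ t -> -> _; rewrite /= !scaler0 addr0.
  have [||phi [dphi phi_le phid]] := @separation R X [set 0] (d k) `|d k| c0.
  - by exists 0.
  - by move=> _ ->; rewrite subr0.
  exists phi; split=> //; have := phid 0 erefl.
  by rewrite (dual0 dphi) add0r.
exists phi; split=> [k|z /closure_normP dz phiz]; first by have [] := phiP k.
apply/eqP; rewrite -normr_eq0 eq_le normr_ge0 andbT leNgt; apply/negP => z0.
have [_ [k _ <-] zk] := dz (`|z| / 2) (divr_gt0 z0 (ltr0n _ 2)).
have [/dual_linear[_ phiB _] /(_ (d k - z)) + dk] := phiP k.
rewrite phiB phiz subr0 distrC => dkz.
have := ler_normD (z - d k) (d k); rewrite subrK; lra.
Qed.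

(** Whitley's argument.  Let [x] be the weak limit of [u] along an ultrafilter,
    and [phi k] a sequence of functionals that separates the points of the
    closed span of [u].  Choose [s n] so that [phi k (u (s n))] is within
    [1 / (n + 1)] of [phi k x] for all [k <= n].  Any weak limit of [u \o s]
    along an ultrafilter lies in the closed span and agrees with [x] on every
    [phi k], so it is [x].  The bound [n <= s n] sends [s] to infinity. *)
Theorem weak_sequential_compactness (hX : reflexive_space X) u (M : R) :
  (forall n, `|u n| <= M) ->
  exists s : nat -> nat, (forall n, (n <= s n)%N) /\
    exists x, weakly_cvg (u \o s) x.
Proof.
move=> uM.
pose d k := if unpickle k is Some s then rat_comb u s else 0.
have rd : range (rat_comb u) `<=` range d.
  by move=> _ [s _ <-]; exists (pickle s) => //; rewrite /d pickleK.
pose Y := closure (range (rat_comb u)).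
have Yd : Y `<=` closure (range d) by exact: closureS.
have Yu n : Y (u n).
  apply: subset_closure; exists [:: (1, n)] => //.
  by rewrite /rat_comb big_seq1 rmorph1 scale1r.
have clY : closed Y by exact: closed_closure.
have cY : @convex_set R X Y.
  by apply/convex_setP => x y t Yx Yy _; apply: closure_rat_combD;
    exact: closure_rat_combZ.
have [phi [dphi phi_total]] := total_sequence d.
have [U [UU FU]] := ultraFilterLemma eventually_filter.
have Uinf n : U [set m | (n <= m)%N] by apply: FU; exists n.
have [|x ux] := @ultra_weak_limit _ _ hX _ U UU u M.
  by apply: FU; exists 0%N => // n _ /=.
have Yx : Y x.
  by apply: (@mazur _ _ _ U _ u _ _ clY cY ux); apply: nearW.
have /choice[s sP] (n : nat) : exists m, (n <= m)%N /\
    forall k, (k <= n)%N -> `|phi k x - phi k (u m)| < n.+1%:R^-1.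
  have Uphi k : U [set m | `|phi k x - phi k (u m)| < n.+1%:R^-1].
    have /cvgrPdist_lt/(_ n.+1%:R^-1) := ux _ (dphi k); apply.
    by rewrite invr_gt0.
  have : U [set m | forall k, (k <= n)%N ->
                              `|phi k x - phi k (u m)| < n.+1%:R^-1].
    elim: {1}n => [|i IH].
      by apply: filterS (Uphi 0%N) => m ? [|].
    apply: filterS (filterI IH (Uphi i.+1)) => m [h1 h2] k.
    by rewrite leq_eqVlt => /predU1P[->//|]; rewrite ltnS; exact: h1.
  move=> h; have [m [? ?]] := filter_ex (filterI (Uinf n) h).
  by exists m.
exists s; split=> [n|]; first by case: (sP n).
have sphi k : phi k ((u \o s) n) @[n --> \oo] --> phi k x.
  apply/cvgrPdist_lt => e e0; near=> n; apply: lt_trans (_ : n.+1%:R^-1 < _).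
    apply: (sP n).2; near: n; exact: nbhs_infty_ge.
  near: n; exact: near_infty_natSinv_lt (PosNum e0).
exists x => psi dpsi; apply: cvg_ultra => W UW FW.
have [|x' ux'] := @ultra_weak_limit _ _ hX _ W UW (u \o s) M.
  by apply: FW; exists 0%N => // n _ /=.
have Yx' : Y x'.
  apply: (@mazur _ _ _ W _ (u \o s) _ _ clY cY ux').
  by apply: nearW => n; exact: Yu.
have xx' : x' - x = 0.
  apply: phi_total => [|k].
    apply: Yd; apply: closure_rat_combD => //; rewrite -scaleN1r.
    exact: closure_rat_combZ.
  have [_ -> _] := dual_linear (dphi k); apply/eqP; rewrite subr_eq0; apply/eqP.
  apply: (@cvg_unique R^o _ (phi k ((u \o s) n) @[n --> W])).
  - exact: Rhausdorff.
  - exact: (ux' _ (dphi k)).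
  - apply: cvg_trans (sphi k); exact: cvg_app.
have -> : x = x' by apply/esym/eqP; rewrite -subr_eq0 xx'.
exact: ux'.
Unshelve. all: by end_near. Qed.

End sequential_compactness.

(** * Closed convex hulls *)
Section convex_sets.
Context {R : realType} {X : normedModType R}.
Implicit Types (A C : set X).

Lemma convex_bigcap (I : Type) (D : set I) (C : I -> set X) :
  (forall i, D i -> @convex_set R X (C i)) ->
  @convex_set R X (\bigcap_(i in D) C i).
Proof.
move=> cC; apply/convex_setP => x y t Cx Cy t01 i Di.
by move/convex_setP : (cC i Di); apply=> //; [exact: Cx|exact: Cy].
Qed.

Lemma convex_setI A C : @convex_set R X A -> @convex_set R X C ->
  @convex_set R X (A `&` C).
Proof.
move=> /convex_setP cA /convex_setP cC.
by apply/convex_setP => x y t [? ?] [? ?] t01; split; [exact: cA|exact: cC].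
Qed.

Lemma convex_norm_ball (M : R) : @convex_set R X [set x | `|x| <= M].
Proof.
apply/convex_setP => x y t /= xM yM /andP[t0 t1].
rewrite (le_trans (ler_normD _ _))// !normrZ !ger0_norm ?subr_ge0//.
have := ler_wpM2l t0 xM; have := ler_wpM2l (_ : 0 <= 1 - t) yM.
by rewrite subr_ge0 => /(_ t1); lra.
Qed.

Lemma closed_norm_ball (M : R) : closed [set x : X | `|x| <= M].
Proof.
apply: (@preimage_closed _ _ (fun x : X => `|x|) [set r | r <= M]).
  by move=> x _; exact: norm_continuous.
exact: closed_le.
Qed.

Lemma convex_closure C : @convex_set R X C -> @convex_set R X (closure C).
Proof.
move=> /convex_setP cC; apply/convex_setP => x y t /closure_normP Cx.
move=> /closure_normP Cy t01; apply/closure_normP => e e0.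
have e20 : 0 < e / 2 by rewrite divr_gt0.
have [a Ca xa] := Cx _ e20; have [b Cb yb] := Cy _ e20.
exists (t *: a + (1 - t) *: b); first exact: cC.
rewrite opprD addrACA -!scalerBr (le_lt_trans (ler_normD _ _))//.
move: t01 => /andP[t0 t1]; rewrite !normrZ !ger0_norm ?subr_ge0//.
have h1 : t * `|x - a| <= `|x - a| by rewrite ler_piMl.
have h2 : (1 - t) * `|y - b| <= `|y - b| by rewrite ler_piMl// gerBl.
by rewrite [e]splitr (le_lt_trans (lerD h1 h2))// ltrD.
Qed.

Lemma sub_closed_convex_hull A : A `<=` closed_convex_hull A.
Proof.
by apply: subset_trans (@subset_closure _ _); exact: sub_gen_smallest.
Qed.

Lemma closed_convex_hull_min A C : closed C -> @convex_set R X C ->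
  A `<=` C -> closed_convex_hull A `<=` C.
Proof.
move=> /closure_id CE cC AC; rewrite [X in _ `<=` X]CE.
by apply: closureS; exact: smallest_sub.
Qed.

Lemma closed_convex_hull_closed A : closed (closed_convex_hull A).
Proof. exact: closed_closure. Qed.

Lemma closed_convex_hull_convex A : @convex_set R X (closed_convex_hull A).
Proof. by apply: convex_closure; apply: convex_bigcap => C []. Qed.

Lemma closed_convex_hullS A C : A `<=` C ->
  closed_convex_hull A `<=` closed_convex_hull C.
Proof.
move=> AC; apply: closed_convex_hull_min.
- exact: closed_convex_hull_closed.
- exact: closed_convex_hull_convex.
- exact: subset_trans AC (@sub_closed_convex_hull _).
Qed.

End convex_sets.

(** * Intersection theorems for closed convex sets *)
Section reflexive.
Context {R : realType} {X : normedModType R}.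
Hypothesis hX : reflexive_space X.

(** The sets belong to an ultrafilter by the finite intersection property, and
    by Mazur's theorem its weak limit belongs to each of them. *)
Theorem weak_compactness (I : choiceType) (D : set I) (C : I -> set X)
    (i0 : I) (M : R) :
  D i0 -> (forall x, C i0 x -> `|x| <= M) ->
  (forall i, D i -> closed (C i)) ->
  (forall i, D i -> @convex_set R X (C i)) ->
  finI D C -> \bigcap_(i in D) C i !=set0.
Proof.
move=> Di0 CM clC cC /finI_filter PF.
have [U [UU FU]] := ultraFilterLemma PF.
have UC i : D i -> U (C i).
  by move=> Di; apply: FU; exists (C i) => //; exact: finI_from1.
have [|x Ux] := @ultra_weak_limit _ _ hX X U UU id M.
  exact: filterS (UC _ Di0).
exists x => i Di.
exact: (@mazur _ _ _ U _ id _ _ (clC i Di) (cC i Di) Ux (UC i Di)).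
Qed.

(** Suppose that [A], the intersection of all the sets but [C a], misses [C a]
    within [D], and separate the two strictly by a hyperplane.  The hyperplane
    section of [D] is covered by the remaining sets.  For each [i] among them,
    the segment from a point of [A] to a point common to all the sets but [C i]
    crosses the hyperplane, so the remaining sets satisfy the hypotheses on the
    section.  By induction they meet there, but [A] misses the hyperplane. *)
Theorem klee (I : eqType) (C : I -> set X) (M : R) (s : seq I) (D : set X) :
  uniq s -> s != [::] ->
  (forall i, i \in s -> closed (C i)) ->
  (forall i, i \in s -> @convex_set R X (C i)) ->
  closed D -> @convex_set R X D -> (forall x, D x -> `|x| <= M) ->
  (forall x, D x -> exists2 i, i \in s & C i x) ->
  (forall i, i \in s ->
     exists2 z, D z & forall j, j \in s -> j != i -> C j z) ->
  exists2 z, D z & forall j, j \in s -> C j z.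
Proof.
elim: s D => // a t IH D /= /andP[at_ ut] _ clC cC clD cD DM cov pt.
have [t0|t0] := eqVneq t [::].
  rewrite {}t0 in cov pt *; have [z Dz _] := pt a (mem_head _ _).
  exists z => // j; have [i] := cov z Dz.
  by rewrite !inE => /eqP-> Caz /eqP->.
apply: contrapT => nz.
pose A := D `&` \bigcap_(j in [set j | j \in t]) C j.
pose B := D `&` C a.
have tas j : j \in t -> j \in a :: t by rewrite inE orbC => ->.
have clA : closed A.
  by apply: closedI => //; apply: closed_bigI => j /tas; exact: clC.
have cA : @convex_set R X A.
  by apply: convex_setI => //; apply: convex_bigcap => j /tas; exact: cC.
have clB : closed B by apply: closedI => //; apply: clC; exact: mem_head.
have cB : @convex_set R X B.
  by apply: convex_setI => //; apply: cC; exact: mem_head.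
have [a0 Aa0] : A !=set0.
  have [z Dz Cz] := pt a (mem_head _ _); exists z; split=> // j /= jt.
  by apply: Cz; [exact: tas|apply: contraNneq at_ => <-].
have Bpt i : i \in t ->
    exists2 z, B z & forall j, j \in t -> j != i -> C j z.
  move=> it; have [z Dz Cz] := pt i (tas _ it); exists z.
    split=> //; apply: Cz; first exact: mem_head.
    by apply: contraNneq at_ => ->.
  by move=> j /tas; exact: Cz.
have B0 : B !=set0.
  case: t t0 Bpt {IH ut clC cC cov pt A clA cA a0 Aa0 tas nz at_} => // b t _.
  by move=> /(_ b (mem_head _ _))[z Bz _]; exists z.
have AB0 : A `&` B = set0.
  apply/seteqP; split=> // z [[Dz Cz] [_ Caz]]; apply: nz; exists z => // j.
  by rewrite inE => /predU1P[->//|]; exact: Cz.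
have AM z : A z -> `|z| <= M by move=> [/DM].
have [phi [r [dphi phiA phiB]]] :=
  strict_separation hX clA clB cA cB (ex_intro _ _ Aa0) B0 AM AB0.
have [phiD _ phiZ] := dual_linear dphi.
pose D' := D `&` [set z | phi z = r].
have [|||||z|i it|] := IH D' ut t0.
- by move=> i /tas; exact: clC.
- by move=> i /tas; exact: cC.
- apply: closedI => //; apply: (@preimage_closed _ R^o phi [set r]).
    by move=> x _; case: dphi => _; exact.
  exact: closed_eq.
- apply: convex_setI => //; apply/convex_setP => x y l /= xr yr _.
  by rewrite phiD !phiZ xr yr; ring.
- by move=> x [/DM].
- move=> [Dz zr]; have [i] := cov z Dz.
  rewrite inE => /predU1P[->|]; last by exists i.
  by move=> Caz; have := phiB z (conj Dz Caz); rewrite zr ltxx.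
- have [b Bb Cb] := Bpt i it; have := phiB b Bb; have := phiA a0 Aa0.
  move=> ra br; pose l := (r - phi b) / (phi a0 - phi b).
  have ba : 0 < phi a0 - phi b by lra.
  have l01 : 0 <= l <= 1.
    by rewrite /l divr_ge0 ?ler_pdivrMr ?mul1r//; lra.
  exists (l *: a0 + (1 - l) *: b).
    split; first by move/convex_setP : cD; apply=> //; [case: Aa0|case: Bb].
    rewrite /= phiD !phiZ.
    have : l * (phi a0 - phi b) = r - phi b by rewrite /l divfK// lt0r_neq0.
    lra.
  move=> j jt ji; move/convex_setP : (cC j (tas _ jt)); apply=> //.
    by case: Aa0 => _; exact.
  exact: Cb.
- move=> z [Dz zr] Cz; have := phiA z (conj Dz Cz); by rewrite zr ltxx.
Qed.

(** By induction on the number of points, all the sets but one meet within the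
    hull of the other points; this is the hypothesis of Klee's theorem. *)
Theorem convex_kkm (G : X -> set X) (s : seq X) :
  s != [::] ->
  (forall y, y \in s -> closed (G y)) ->
  (forall y, y \in s -> @convex_set R X (G y)) ->
  (forall t, t != [::] -> {subset t <= s} ->
     forall x, closed_convex_hull [set` t] x -> exists2 y, y \in t & G y x) ->
  exists2 x, closed_convex_hull [set` s] x & forall y, y \in s -> G y x.
Proof.
wlog us : s / uniq s.
  move=> wl s0 clG cG cov; have sE : undup s =i s by exact: mem_undup.
  have [||||x hx Gx] := wl (undup s) (undup_uniq s).
  - apply: contraNneq s0 => u0; case: (s) u0 sE => // a ? u0 /(_ a).
    by rewrite u0 mem_head.
  - by move=> y; rewrite sE; exact: clG.
  - by move=> y; rewrite sE; exact: cG.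
  - by move=> t t0 ts; apply: cov => // y /ts; rewrite sE.
  - exists x; last by move=> y; rewrite -sE; exact: Gx.
    by apply: closed_convex_hullS hx => y /=; rewrite sE.
have [n] := ubnP (size s); elim: n s us => // n IH s us sn s0 clG cG cov.
pose M : R := \sum_(y <- s) `|y|.
have sM y : y \in s -> `|y| <= M.
  by move=> ys; rewrite /M (big_rem _ ys)/= lerDl sumr_ge0.
apply: (@klee X G M s) => //.
- exact: closed_convex_hull_closed.
- exact: closed_convex_hull_convex.
- apply: closed_convex_hull_min.
  + exact: closed_norm_ball.
  + exact: convex_norm_ball.
  + by move=> y /=; exact: sM.
- by apply: cov.
- move=> i is_; have [r0|r0] := eqVneq (rem i s) [::].
    exists i; first exact: sub_closed_convex_hull.
    move=> j js ji; have : j \in rem i s by rewrite mem_rem_uniq// !inE ji.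
    by rewrite r0.
  have rs : {subset rem i s <= s} by exact: mem_rem.
  have [||||x hx Gx] := IH (rem i s) (rem_uniq _ us) _ r0.
  - by rewrite size_rem//; case: (s) sn is_ => //= ? ? /ltnW.
  - by move=> y /rs; exact: clG.
  - by move=> y /rs; exact: cG.
  - by move=> t t0 ts; apply: cov => // y /ts /rs.
  exists x; first exact: closed_convex_hullS hx.
  by move=> j js ji; apply: Gx; rewrite mem_rem_uniq// !inE ji.
Qed.

End reflexive.

(** * Lower semicontinuous quasiconvex regularization *)
Section regularization.
Context {R : realType} {X : normedModType R}.
Variables (K : set X) (f : X -> X -> R).
Hypothesis fQ : in_Qbar K f.

Lemma bifun_regE x y : K x -> K y ->
  (bifun_reg K f x y)%:E = bifun_reg_ereal K f x y.
Proof. by move=> Kx Ky; rewrite fineK// fQ. Qed.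

Lemma bifun_reg_le x y (l : R) : K x -> K y ->
  closed_convex_hull (sublevel (extend_pinfty K (f x)) l) y ->
  bifun_reg K f x y <= l.
Proof.
move=> Kx Ky hy; rewrite -lee_fin bifun_regE//.
by apply: ereal_inf_lbound; exists l.
Qed.

Lemma bifun_reg_le_bifun x y : K x -> K y -> bifun_reg K f x y <= f x y.
Proof.
move=> Kx Ky; apply: bifun_reg_le => //; apply: sub_closed_convex_hull.
by rewrite /sublevel/= /extend_pinfty patchT ?inE.
Qed.

(** The infimum that defines the regularization need not be attained, hence the
    intersection over all levels above [l]. *)
Lemma sublevel_bifun_reg x (l : R) : K x ->
  K `&` [set z | bifun_reg K f x z <= l] =
  K `&` \bigcap_(m in [set m | l < m])
          closed_convex_hull (sublevel (extend_pinfty K (f x)) m).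
Proof.
move=> Kx; apply/seteqP; split=> z [Kz] /= zl; split=> //.
- move=> m /= lm; have : (bifun_reg_ereal K f x z < m%:E)%E.
    by rewrite -bifun_regE// lte_fin (le_lt_trans zl).
  move=> /ereal_inf_lt[_ [l' hz <-]]; rewrite lte_fin => l'm.
  apply: closed_convex_hullS hz => w; rewrite /sublevel/= => /le_trans; apply.
  by rewrite lee_fin ltW.
- apply/ler_addgt0Pr => e e0; apply: bifun_reg_le => //; apply: zl => /=.
  by rewrite ltrDl.
Qed.

Lemma closed_sublevel_bifun_reg x (l : R) : closed K -> K x ->
  closed (K `&` [set z | bifun_reg K f x z <= l]).
Proof.
move=> clK Kx; rewrite sublevel_bifun_reg//; apply: closedI => //.
by apply: closed_bigI => m _; exact: closed_convex_hull_closed.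
Qed.

Lemma convex_sublevel_bifun_reg x (l : R) : @convex_set R X K -> K x ->
  @convex_set R X (K `&` [set z | bifun_reg K f x z <= l]).
Proof.
move=> cK Kx; rewrite sublevel_bifun_reg//; apply: convex_setI => //.
by apply: convex_bigcap => m _; exact: closed_convex_hull_convex.
Qed.

End regularization.

(** * Equilibrium problems *)
Section equilibrium.
Context {R : realType} {X : normedModType R}.

(** Closed hulls replace the usual convex hulls of finite sets.  The negation
    still provides local Minty solutions, and the sets to which Klee's theorem
    applies are then closed by construction. *)
Definition properly_quasimonotone (K : set X) (g : X -> X -> R) : Prop :=
  forall (s : seq X) x, s != [::] -> (forall y, y \in s -> K y) ->
    closed_convex_hull [set` s] x -> exists2 y, y \in s & g y x <= 0.

Variables (K : set X) (g : X -> X -> R).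
Hypothesis hX : reflexive_space X.
Hypothesis K0 : K !=set0.
Hypothesis clK : closed K.
Hypothesis cK : @convex_set R X K.
Hypothesis g_closed : forall x, K x -> closed (K `&` [set z | g x z <= 0]).
Hypothesis g_convex : forall x, K x ->
  @convex_set R X (K `&` [set z | g x z <= 0]).
Hypothesis gss : forall x, K x -> semistrictly_quasiconvex_on K (g x).
Hypothesis gqm : quasimonotone K g.
Hypothesis gus : upper_sign_property K g.

(** Applied with [y = x], the upper sign property says that [g x x <= 0] implies
    [0 <= g x x], and quasimonotonicity that [g x x] is not positive. *)
Lemma bifun_diag x : K x -> g x x = 0.
Proof.
move=> Kx; apply/eqP; rewrite eq_le; apply/andP; split.
  by rewrite leNgt; apply/negP => gx; have := gqm Kx Kx gx; rewrite leNgt gx.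
have [gx|/ltW//] := leP (g x x) 0; apply: gus => // t _.
by rewrite -scalerDl subrK scale1r.
Qed.

(** The segments that the upper sign property looks at remain in [K']. *)
Lemma minty_stampacchia K' x : K' `<=` K -> @convex_set R X K' -> K' x ->
  (forall z, K' z -> g z x <= 0) -> forall y, K' y -> 0 <= g x y.
Proof.
move=> K'K /convex_setP cK' K'x minty y K'y.
apply: gus; [exact: K'K|exact: K'K|].
move=> t /andP[t0 t1]; apply: minty; rewrite addrC; apply: cK' => //.
by rewrite !ltW.
Qed.

(** Here [g x v = 0], so [g x y < 0] would propagate by semistrict
    quasiconvexity to the open segment from [y] to [v], and thus to points near
    [v].  The point [v] may differ from [x]: the coercivity condition
    produces such a [v] in the interior of a ball when [x] is on its sphere. *)
Lemma local_to_global x v e : 0 < e -> K x -> K v -> g x v <= 0 ->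
  (forall y, K y -> `|y - v| < e -> 0 <= g x y) -> EP g K x.
Proof.
move=> e0 Kx Kv gxv loc; split=> // y Ky; rewrite leNgt; apply/negP => gxy.
have gv : g x v = 0 by apply/eqP; rewrite eq_le gxv loc// subrr normr0.
have d0 : 0 < e + `|y - v| + 1 by rewrite -addrA addr_gt0// ltr_wpDl.
(* Small enough for the point of parameter [t] to be within [e] of [v]. *)
pose t := e / (e + `|y - v| + 1).
have t01 : 0 < t < 1.
  rewrite divr_gt0//= ltr_pdivrMr// mul1r -addrA ltrDl.
  by rewrite ltr_wpDl.
have [_ /(_ y v Ky Kv)] := gss Kx; rewrite gv => /(_ gxy t t01).
apply/negP; rewrite -leNgt; apply: loc.
  by move/convex_setP : cK; apply=> //; case/andP : t01 => *; rewrite !ltW.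
have -> : t *: y + (1 - t) *: v - v = t *: (y - v).
  by rewrite scalerBl scale1r scalerBr addrA addrAC addrK.
rewrite normrZ gtr0_norm; last by case/andP: t01.
by rewrite /t mulrAC ltr_pdivrMr// ltr_pM2l// addrAC ltr_pwDl// ltr_wpDr.
Qed.

Lemma local_minty x e : 0 < e -> K x ->
  (forall z, K z -> `|z - x| < e -> g z x <= 0) -> EP g K x.
Proof.
move=> e0 Kx minty.
apply: (local_to_global e0 Kx Kx); first by rewrite bifun_diag.
move=> y Ky yx; pose K' := K `&` ball x e.
have K'P z : K z -> `|z - x| < e -> K' z.
  by move=> Kz zx; split=> //; rewrite -ball_normE /ball_/= distrC.
apply: (@minty_stampacchia K').
- by move=> z [].
- apply/convex_setP => a b t [Ka]; rewrite -ball_normE /ball_/= => xa [Kb].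
  rewrite -ball_normE /ball_/= => xb /andP[t0 t1].
  apply: K'P; first by move/convex_setP : cK; apply=> //; rewrite t0 t1.
  have -> : t *: a + (1 - t) *: b - x = t *: (a - x) + (1 - t) *: (b - x).
    rewrite !scalerBr addrACA -opprD -scalerDl addrCA subrr addr0.
    by rewrite scale1r.
  rewrite (le_lt_trans (ler_normD _ _))// !normrZ !ger0_norm ?subr_ge0//.
  rewrite (distrC a) (distrC b).
  have [->|tn0] := eqVneq t 0; first by rewrite mul0r subr0 mul1r add0r.
  have tp : 0 < t by rewrite lt_neqAle eq_sym tn0.
  have h1 : t * `|x - a| < t * e by rewrite ltr_pM2l.
  have h2 : (1 - t) * `|x - b| <= (1 - t) * e.
    by rewrite ler_wpM2l ?subr_ge0// ltW.
  by rewrite (lt_le_trans (ltr_leD h1 h2))// -mulrDl addrC subrK mul1r.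
- by apply: K'P => //; rewrite subrr normr0.
- move=> z [Kz]; rewrite -ball_normE /ball_/= distrC; exact: minty.
- exact: K'P.
Qed.

(** Closedness of the sublevel sets keeps [g y z > 0] for [z] near [x].  Then
    [g z y <= 0] for all [y] in [s], and [x] lies in the closed convex hull of
    [s], so [g z x <= 0]: the point [x] is a local Minty solution. *)
Lemma local_minty_of_hull (s : seq X) x : (forall y, y \in s -> K y) ->
  closed_convex_hull [set` s] x -> (forall y, y \in s -> 0 < g y x) ->
  EP g K x.
Proof.
move=> sK sx gx.
have Kx : K x by exact: closed_convex_hull_min sx.
have [e e0 ge] : exists2 e, 0 < e &
    forall z, K z -> `|z - x| < e -> forall y, y \in s -> 0 < g y z.
  elim: s sK gx {sx} => [|y s IH] sK gx; first by exists 1.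
  have [|z zs|e e0 ge] := IH.
  - by move=> z zs; apply: sK; rewrite inE zs orbT.
  - by apply: gx; rewrite inE zs orbT.
  have Ky : K y by apply: sK; exact: mem_head.
  have gy := gx y (mem_head _ _).
  have [d d0 gd] : exists2 d, 0 < d &
      forall z, K z -> `|z - x| < d -> 0 < g y z.
    apply: contrapT => nd.
    have : (K `&` [set z | g y z <= 0]) x.
      apply: (g_closed Ky); apply/closure_normP => d d0.
      apply: contrapT => nz; apply: nd; exists d => // z Kz zx.
      rewrite ltNge; apply/negP => gz; apply: nz; exists z => //.
      by rewrite distrC.
    by move=> [_ /=]; rewrite leNgt gy.
  exists (Num.min e d); first by rewrite lt_min e0 d0.
  move=> z Kz; rewrite lt_min => /andP[ze zd] w.
  by rewrite inE => /predU1P[->|ws]; [exact: gd|exact: ge].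
apply: (local_minty e0 Kx) => z Kz zx.
suff [] : (K `&` [set w | g z w <= 0]) x by [].
apply: closed_convex_hull_min sx; [exact: g_closed|exact: g_convex|].
by move=> y ys; split; [exact: sK|apply: gqm => //; [exact: sK|exact: ge]].
Qed.

Hypothesis g_pqm : properly_quasimonotone K g.

(** On a ball, the Minty solutions form the intersection of the closed convex
    sets [C y]; proper quasimonotonicity is the hypothesis of [convex_kkm] for
    them, whence the finite intersection property. *)
Lemma minty_truncation (M : R) k0 : K k0 -> `|k0| <= M ->
  exists x, [/\ K x, `|x| <= M & forall y, K y -> `|y| <= M -> g y x <= 0].
Proof.
move=> Kk0 k0M; pose KM := K `&` [set z | `|z| <= M].
have clKM : closed KM by apply: closedI => //; exact: closed_norm_ball.
have cKM : @convex_set R X KM.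
  by apply: convex_setI => //; exact: convex_norm_ball.
pose C y := KM `&` (K `&` [set z | g y z <= 0]).
have clC y : KM y -> closed (C y).
  by move=> [Ky _]; apply: closedI => //; exact: g_closed.
have cC y : KM y -> @convex_set R X (C y).
  by move=> [Ky _]; apply: convex_setI => //; exact: g_convex.
have [||||x Cx] := @weak_compactness _ _ hX X KM C k0 M (conj Kk0 k0M).
- by move=> x [[]].
- exact: clC.
- exact: cC.
- move=> D DKM.
  have [D0|D0] := eqVneq (finmap.enum_fset D) [::].
    exists k0 => y /= yD; have : y \in finmap.enum_fset D by exact: yD.
    by rewrite D0.
  have DK y : y \in finmap.enum_fset D -> KM y by move=> /DKM/set_mem.
  have [|||x _ Cx] := @convex_kkm _ _ hX C (finmap.enum_fset D) D0.
  + by move=> y /DK; exact: clC.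
  + by move=> y /DK; exact: cC.
  + move=> t t0 tD x tx.
    have [Kx xM] : KM x by apply: closed_convex_hull_min tx => // y /tD/DK.
    have [|y yt gyx] := g_pqm t0 _ tx; first by move=> y /tD/DK[].
    by exists y.
  + by exists x => y yD; exact: Cx.
- have [[Kx xM] _] := Cx k0 (conj Kk0 k0M).
  by exists x; split=> // y Ky yM; have [_ []] := Cx y (conj Ky yM).
Qed.

Hypothesis gC3 : coercivity_C3 K g.

(** Unless a truncated Minty solution is interior, the solutions [w n] lie on
    spheres of growing radius; [u] selects terms of [w] of growing norm
    whose directions converge weakly, and the coercivity condition applies to
    it. *)
Lemma EP_of_properly_quasimonotone : EP g K !=set0.
Proof.
have [k0 Kk0] := K0.
have [[x xEP]|nEP] := pselect (EP g K !=set0); first by exists x.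
pose N := `|k0|; have N0 : 0 <= N by exact: normr_ge0.
have /choice[w wP] (n : nat) : exists x, [/\ K x, `|x| = N + n.+1%:R &
    forall y, K y -> `|y| <= N + n.+1%:R -> g y x <= 0].
  have [|x [Kx xM minty]] := @minty_truncation (N + n.+1%:R) k0 Kk0.
    by rewrite lerDl.
  exists x; split=> //; apply/eqP; rewrite eq_le xM/= leNgt; apply/negP => xlt.
  apply: nEP; exists x; apply: (@local_minty x (N + n.+1%:R - `|x|)) => //.
    by rewrite subr_gt0.
  move=> z Kz zx; apply: minty => //.
  have := ler_normD (z - x) x; rewrite subrK; lra.
have wpos n : 0 < `|w n| by have [_ -> _] := wP n; rewrite ltr_wpDl.
have [|s [sn [x wx]]] := @weak_sequential_compactness _ _ hX
  (fun n => `|w n|^-1 *: w n) 1.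
  by move=> n; rewrite normrZ normfV normr_id mulVf// lt0r_neq0.
pose u n := w (s n).
have Ku n : K (u n) by have [] := wP (s n).
have upos n : 0 < `|u n| by exact: wpos.
have uoo : `|u n| @[n --> \oo] --> +oo.
  apply/cvgryPge => A; near=> n; have [_ -> _] := wP (s n).
  apply: le_trans (_ : n%:R <= _); first by near: n; exact: nbhs_infty_ger.
  by rewrite ler_wpDl// ler_nat (leq_trans (sn n)).
have uinv : `|u n|^-1 @[n --> \oo] --> (0 : R^o).
  by apply/gtr0_cvgV0 => //; apply: nearW.
have [||v [Kv uv]] := gC3 _ uoo wx.
- by move=> n; split=> //; rewrite -normr_gt0.
- move=> y Ky.
  (* The points [c n] converge weakly to [y + x], and belong to the sublevel set
     of [y] as soon as [1 <= |u n|] and [|y| <= |u n|]. *)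
  pose c n := (1 - `|u n|^-1) *: y + `|u n|^-1 *: u n.
  have cx phi : dual_space phi -> phi (c n) @[n --> \oo] --> phi (y + x).
    move=> dphi; have [phiD _ phiZ] := dual_linear dphi.
    have -> : (fun n => phi (c n)) =
        (fun n => (1 - `|u n|^-1) * phi y + phi (`|u n|^-1 *: u n)).
      by apply/funext => n; rewrite /c phiD phiZ.
    rewrite phiD; apply: cvgD; last exact: wx.
    rewrite -[X in _ --> X]mul1r; apply: cvgMr_tmp.
    rewrite -[X in _ --> X]subr0; apply: cvgB => //; exact: cvg_cst.
  have [] : (K `&` [set z | g y z <= 0]) (y + x).
    apply: (@mazur _ _ _ \oo _ c _ _ (g_closed Ky) (g_convex Ky) cx).
    near=> n.
    have u1 : 1 <= `|u n| by near: n; move/cvgryPge : uoo; exact.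
    rewrite /c addrC.
    have := g_convex Ky => /convex_setP; apply.
    + split=> //; have [_ + minty] := wP (s n); rewrite -/(u n) => uE.
      apply: minty => //; rewrite -uE; near: n; move/cvgryPge : uoo; exact.
    + by split=> //=; rewrite bifun_diag.
    + by rewrite invr_ge0 normr_ge0/= invf_le1.
  by rewrite addrC.
near \oo => n.
have [vu guv] : `|v n| < `|u n| /\ g (u n) (v n) <= 0 by near: n.
exists (u n); apply: (@local_to_global _ (v n) (`|u n| - `|v n|)) => //.
  by rewrite subr_gt0.
have [_ uE minty] := wP (s n); rewrite -/(u n) in uE minty.
move=> y Ky yv; apply: (@minty_stampacchia (K `&` [set z | `|z| <= `|u n|])).
- by move=> z [].
- by apply: convex_setI => //; exact: convex_norm_ball.
- by split=> /=.
- by move=> z [Kz /= zu]; apply: minty; rewrite -?uE.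
- split=> //=; have := ler_normD (y - v n) (v n); rewrite subrK; lra.
Unshelve. all: by end_near. Qed.

End equilibrium.

Theorem EP_nonempty (R : realType) (X : normedModType R)
  (hX : reflexive_space X) (K : set X) (g : X -> X -> R) :
  K !=set0 -> closed K -> @convex_set R X K ->
  (forall x, K x -> closed (K `&` [set z | g x z <= 0])) ->
  (forall x, K x -> @convex_set R X (K `&` [set z | g x z <= 0])) ->
  (forall x, K x -> semistrictly_quasiconvex_on K (g x)) ->
  quasimonotone K g -> upper_sign_property K g -> coercivity_C3 K g ->
  EP g K !=set0.
Proof.
move=> K0 clK cK g_closed g_convex gss gqm gus gC3.
have [pqm|npqm] := pselect (properly_quasimonotone K g).
  exact: EP_of_properly_quasimonotone.
apply: contrapT => nEP; apply: npqm => s x _ sK sx; apply: contrapT => ny.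
apply: nEP; exists x.
apply: (local_minty_of_hull clK cK g_closed g_convex gss gqm gus sK sx).
by move=> y ys; rewrite ltNge; apply/negP => gyx; apply: ny; exists y.
Qed.

Theorem proposition5p3 (R : realType) (X : completeNormedModType R)
  (hX : reflexive_space X)
  (K : set X) (K0 : K !=set0) (Kclosed : closed K)
  (Kconvex : convex_set (K : set (convex_lmodType X)))
  (f : X -> X -> R) (fSQ : in_SQbar K f)
  (fqm : quasimonotone K (bifun_reg K f))
  (fus : upper_sign_property K (bifun_reg K f))
  (fC3 : coercivity_C3 K (bifun_reg K f)) :
  EP f K !=set0.
Proof.
have [fQ fss] := fSQ.
have [||x [Kx gx]] := EP_nonempty hX K0 Kclosed Kconvex _ _ fss fqm fus fC3.
- by move=> x Kx; exact: closed_sublevel_bifun_reg.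
- by move=> x Kx; exact: convex_sublevel_bifun_reg.
exists x; split=> // y Ky.
exact: le_trans (gx y Ky) (bifun_reg_le_bifun fQ Kx Ky).
Qed.
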